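(* Let $\mathbb{C}$ be an initial configuration on $S$ stacks, and let $V_1,\dots,V_k$ be $k$ pairwise non-overlapping (disjoint) virtual layers, each of which satisfies P5. Then in every feasible move sequence for $\mathbb{C}$, at least $k$ non-BG moves are implemented on the blocks of $V_1\cup\dots\cup V_k$.
   Context: Setting (block relocation problem). There are $S$ stacks and $B$ blocks labelled by $\mathbb{B}=\{1,\dots,B\}$; a smaller label means a higher priority (earlier retrieval). A configuration places blocks in the stacks, each stack being a finite vertical sequence of blocks; the initial configuration $\mathbb{C}$ contains every block exactly once. A stack height limit $H$ may be imposed (each stack holds at most $H$ blocks; $H=\infty$ if there is no limit). A relocation takes the topmost block of a stack and puts it on top of a different stack (respecting the height limit). A retrieval removes from the bay the block of smallest label among those still present, and is allowed only if that block is topmost in its stack. A feasible move sequence is a finite sequence of relocations and retrievals starting from $\mathbb{C}$ after which all blocks have been retrieved. It is assumed that no block is directly retrievable in $\mathbb{C}$ (i.e. block $1$ is not topmost). In a given configuration, a block is badly placed (BP) if some block below it in the same stack has higher priority (smaller label); otherwise it is well placed (WP). A relocation is a BB, BG, GB or GG move, where the first letter is B (resp. G) if the moved block is BP (resp. WP) just before the move, and the second letter is B (resp. G) if it is BP (resp. WP) just after the move. A non-BG move is a BB, GB or GG move. The priority of a stack is the highest priority (smallest label) of a block in it, and $+\infty$ (the lowest priority) if it is empty. A virtual layer is a set of $S$ blocks, one from each stack of $\mathbb{C}$. A virtual layer $V$ satisfies P5 if (1) there exists a block lying in $\mathbb{C}$ below the block of $V$ in its stack, whose priority is higher than the highest priority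 of the blocks in $V$; and (2) the highest priority of the BP blocks (with respect to $\mathbb{C}$) in $V$ is lower than the lowest priority of all stacks after removing the blocks above $V$ (keeping in each stack only the block of $V$ and the blocks below it). *)

(* Defs.v *)
From HB Require Import structures.
From mathcomp Require Import all_boot.

Set Implicit Arguments.
Unset Strict Implicit.
Unset Printing Implicit Defensive.

(* The ordinal i : 'I_B is the block labelled i + 1; a smaller label means a *)
(* higher priority.                                                          *)
Definition label (B : nat) (b : 'I_B) : nat := b.+1.

(* Each stack is listed from top (head of the sequence) to bottom. *)
Definition config (S B : nat) := {ffun 'I_S -> seq 'I_B}.

Definition present (S B : nat) (c : config S B) (b : 'I_B) : bool :=
  [exists s : 'I_S, b \in c s].

Definition below (B : nat) (st : seq 'I_B) (b : 'I_B) : seq 'I_B :=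
  drop (index b st).+1 st.

(* A block that occurs in c is well placed iff it is not badly placed. *)
Definition badly_placed (S B : nat) (c : config S B) (b : 'I_B) : bool :=
  [exists s : 'I_S, has (fun x => label x < label b) (below (c s) b)].

(* The height limit is Some h, or None when there is no limit. *)
Definition fits (H : option nat) (n : nat) : bool :=
  if H is Some h then n <= h else true.

Definition initial_config (S B : nat) (H : option nat) (c : config S B) : Prop :=
  [/\ forall b : 'I_B, \sum_(s < S) count_mem b (c s) = 1,
      forall s : 'I_S, fits H (size (c s))
    & forall s : 'I_S, if c s is b :: _ then label b != 1 else true].

Inductive move (S : nat) : Type :=
  | Relocate (src dst : 'I_S)
  | Retrieve (src : 'I_S).

Definition legal (S B : nat) (H : option nat) (c : config S B) (m : move S)
    : bool :=
  match m with
  | Relocate s t => [&& s != t, c s != [::] & fits H (size (c t)).+1]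
  | Retrieve s =>
      if c s is b :: _ then [forall x, present c x ==> (label b <= label x)]
      else false
  end.

(* Junk value on illegal moves, which feasible rules out. *)
Definition apply_move (S B : nat) (c : config S B) (m : move S) : config S B :=
  match m with
  | Relocate s t =>
      if c s is b :: r then
        [ffun u => if u == s then r else if u == t then b :: c t else c u]
      else c
  | Retrieve s => [ffun u => if u == s then behead (c s) else c u]
  end.

Fixpoint feasible (S B : nat) (H : option nat) (c : config S B)
    (ms : seq (move S)) : bool :=
  if ms is m :: ms' then legal H c m && feasible H (apply_move c m) ms'
  else [forall s : 'I_S, c s == [::]].

Inductive move_kind : Type := BB | BG | GB | GG.

Definition kind (S B : nat) (before after : config S B) (b : 'I_B) : move_kind :=
  match badly_placed before b, badly_placed after b with
  | true, true => BB
  | true, false => BG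
  | false, true => GB
  | false, false => GG
  end.

Definition non_BG (q : move_kind) : bool := if q is BG then false else true.

Definition non_BG_move_on (S B : nat) (U : {set 'I_B}) (c : config S B)
    (m : move S) : bool :=
  if m is Relocate s _ then
    if c s is b :: _ then (b \in U) && non_BG (kind c (apply_move c m) b)
    else false
  else false.

Fixpoint num_non_BG_on (S B : nat) (U : {set 'I_B}) (c : config S B)
    (ms : seq (move S)) : nat :=
  if ms is m :: ms' then
    non_BG_move_on U c m + num_non_BG_on U (apply_move c m) ms'
  else 0.

Definition virtual_layer (S B : nat) (c : config S B) (V : {set 'I_B}) : Prop :=
  #|V| = S /\ forall s : 'I_S, #|[set b in V | b \in c s]| = 1.

(* Smallest label; B.+1 exceeds every label and plays the role of +oo. *)
Definition stack_priority (B : nat) (st : seq 'I_B) : nat :=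
  \big[minn/B.+1]_(b <- st) label b.

Definition set_priority (B : nat) (A : {set 'I_B}) : nat :=
  \big[minn/B.+1]_(b in A) label b.

(* On a stack with a single block of V: that block and those below it. *)
Definition remove_above (B : nat) (V : {set 'I_B}) (st : seq 'I_B) : seq 'I_B :=
  drop (find (mem V) st) st.

(* "Lower priority" is "larger label", so the lowest stack priority is a \max. *)
Definition P5 (S B : nat) (c : config S B) (V : {set 'I_B}) : Prop :=
  (exists s : 'I_S, exists v x : 'I_B,
     [/\ v \in V, v \in c s, x \in below (c s) v & label x < set_priority V])
  /\ \max_(s < S) stack_priority (remove_above V (c s))
     < set_priority [set b in V | badly_placed c b].

(* Main.v *)
Require Import Defs.
From HB Require Import structures.
From mathcomp Require Import all_boot.

Set Implicit Arguments.
Unset Strict Implicit.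
Unset Printing Implicit Defensive.

(** A layer [V] satisfying P5 forces a non-BG move on one of its own blocks, and
    for disjoint layers these moves are distinct. Until a block of [V] moves,
    [V] and everything below it stay in place; by P5(1) the first block [w] of
    [V] to move is then relocated, not retrieved. If [w] is WP the move is GB or
    GG. If it is BP, the remaining part of every stack contains, by P5(2), a
    block of higher priority than [w], so [w] stays BP and the move is BB. *)

Lemma set_priority_le (B : nat) (A : {set 'I_B}) (b : 'I_B) :
  b \in A -> set_priority A <= label b.
Proof.
move=> bA; rewrite /set_priority; have := mem_index_enum b.
elim: (index_enum _) => //= a l IH; rewrite inE big_cons => /predU1P[<-|/IH bl].
  by rewrite bA geq_minl.
by case: ifP => // _; rewrite geq_min bl orbT.
Qed.

Lemma stack_priority_lt (B : nat) (st : seq 'I_B) (b : 'I_B) :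
  stack_priority st < label b -> has (fun x => label x < label b) st.
Proof.
rewrite /stack_priority; elim: st => [|x st IH] /=.
  by rewrite big_nil ltnNge /label ltnS ltnW.
by rewrite big_cons gtn_min => /orP[->//|/IH->]; rewrite orbT.
Qed.

Lemma below_cat (B : nat) (s1 s2 : seq 'I_B) (b : 'I_B) :
  b \notin s1 -> below (s1 ++ s2) b = below s2 b.
Proof.
move=> /negbTE bs1; rewrite /below index_cat bs1 drop_cat ltnNge -addnS leq_addr /=.
by rewrite addKn.
Qed.

Lemma remove_above_head (B : nat) (V : {set 'I_B}) (st r : seq 'I_B) (b : 'I_B) :
  remove_above V st = b :: r -> b \in V.
Proof.
rewrite /remove_above => E.
have hasV : has (mem V) st.
  by rewrite has_find ltnNge; apply/negP => /drop_oversize; rewrite E.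
by have := nth_find b hasV; rewrite -[find _ _]addn0 -nth_drop E.
Qed.

Lemma above_find (B : nat) (V : {set 'I_B}) (st : seq 'I_B) :
  ~~ has (mem V) (take (find (mem V) st) st).
Proof. by rewrite has_take_leq ?find_size // ltnn. Qed.

Section OneLayer.

Variables (S B : nat) (C : config S B) (V : {set 'I_B}).

Definition layer_in_place (c : config S B) : Prop :=
  forall s, exists2 p, c s = p ++ remove_above V (C s) & ~~ has (mem V) p.

Lemma layer_in_place_init : layer_in_place C.
Proof.
by move=> s; exists (take (find (mem V) (C s)) (C s));
  rewrite ?cat_take_drop ?above_find.
Qed.

Lemma below_in_place (c : config S B) (s : 'I_S) (w : 'I_B) :
  layer_in_place c -> w \in V -> below (c s) w = below (C s) w.
Proof.
have notin p : ~~ has (mem V) p -> w \in V -> w \notin p.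
  by move=> pV wV; apply: contra pV => wp; apply/hasP; exists w.
move=> /(_ s)[p -> pV] wV; have [q Cs qV] := layer_in_place_init s.
by rewrite [in RHS]Cs !below_cat ?notin.
Qed.

Lemma badly_placed_in_place (c : config S B) (w : 'I_B) :
  layer_in_place c -> w \in V -> badly_placed c w = badly_placed C w.
Proof. by move=> cV wV; apply: eq_existsb => s; rewrite below_in_place. Qed.

Lemma in_place_behead (c : config S B) (s : 'I_S) (b : 'I_B) (r : seq 'I_B) :
  layer_in_place c -> c s = b :: r -> b \notin V ->
  exists2 p, r = p ++ remove_above V (C s) & ~~ has (mem V) p.
Proof.
move=> /(_ s)[[|a p] -> pV] /=; first by move/remove_above_head => ->.
case=> _ <- _; exists p => //.
by move: pV => /=; rewrite negb_or => /andP[].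
Qed.

Lemma layer_in_place_move (H : option nat) (c : config S B) (m : move S) :
  layer_in_place c -> legal H c m ->
  (forall b r, match m with Relocate s _ | Retrieve s => c s end = b :: r ->
     b \notin V) ->
  layer_in_place (apply_move c m).
Proof.
move=> cV; case: m => [s t|s] /=; case cs: (c s) => [|b r] //=.
- move=> _ /(_ _ _ erefl) bV u; rewrite ffunE; case: eqP => [->|_].
    exact: in_place_behead cs bV.
  case: eqP => [->|_]; last exact: cV.
  have [p -> pV] := cV t; exists (b :: p) => //=.
  by rewrite negb_or bV.
- move=> _ /(_ _ _ erefl) bV u; rewrite ffunE; case: eqP => [->|_].
    exact: in_place_behead cs bV.
  exact: cV.
Qed.

Hypothesis P5V : P5 C V.

Lemma first_relocation_non_BG (c : config S B) (s t : 'I_S) (w : 'I_B)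
    (r : seq 'I_B) :
  layer_in_place c -> s != t -> c s = w :: r -> w \in V ->
  non_BG (kind c (apply_move c (Relocate s t)) w).
Proof.
move=> cV st cs wV; rewrite /kind (badly_placed_in_place cV wV).
case bpw: (badly_placed C w); last by case: badly_placed.
suff -> : badly_placed (apply_move c (Relocate s t)) w by [].
apply/existsP; exists t; rewrite /= cs ffunE eq_sym (negbTE st) eqxx.
rewrite /below /= eqxx drop0; have [p -> _] := cV t.
rewrite has_cat; apply/orP; right; apply: stack_priority_lt.
have [_ maxV] := P5V.
apply: leq_trans (set_priority_le (A := [set b in V | badly_placed C b]) _); last first.
  by rewrite inE wV.
by apply: leq_ltn_trans maxV; rewrite (bigmax_sup t).
Qed.

Lemma num_non_BG_layer_gt0 (H : option nat) (c : config S B) (ms : seq (move S)) :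
  layer_in_place c -> feasible H c ms -> 0 < num_non_BG_on V c ms.
Proof.
have [[s0 [v [x [vV _ xv ltx]]]] _] := P5V.
have xc d : layer_in_place d -> x \in below (d s0) v.
  by move=> dV; rewrite below_in_place.
elim: ms c => [|m ms IH] c cV /=.
  by move=> /forallP/(_ s0)/eqP c0; have := xc _ cV; rewrite c0.
move=> /andP[lm feas]; rewrite addn_gt0.
have [mV|mV] := boolP (non_BG_move_on V c m); first by [].
apply: (IH _ _ feas); apply: (layer_in_place_move cV lm) => b r.
case: m lm mV {feas} => [s t|s] /= lm + cs; rewrite cs in lm *.
  rewrite negb_and => /orP[//|]; apply: contra => bV.
  case/and3P: lm => st _ _.
  by have := first_relocation_non_BG cV st cs bV; rewrite /= cs.
move=> _; apply: contraL ltx => bV; rewrite -leqNgt.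
apply: leq_trans (set_priority_le bV) _.
move: lm => /forallP/(_ x)/implyP; apply.
by apply/existsP; exists s0; apply: mem_drop (xc _ cV).
Qed.

End OneLayer.

Lemma sum_num_non_BG_disjoint (S B k : nat) (V : 'I_k -> {set 'I_B})
    (c : config S B) (ms : seq (move S)) :
  (forall i j, i != j -> [disjoint V i & V j]) ->
  \sum_(i < k) num_non_BG_on (V i) c ms
    <= num_non_BG_on (\bigcup_(i < k) V i) c ms.
Proof.
move=> disj; elim: ms c => [|m ms IH] c /=; first by rewrite big1.
rewrite big_split leq_add //= {IH ms}.
case: m => [s t|s] /=; last by rewrite big1.
case: (c s) => [|b r]; first by rewrite big1.
set q := non_BG _; have [/bigcupP[i _ bi]|bV] := boolP (b \in _).
  rewrite (bigD1 i) //= bi big1 ?addn0 // => j ji.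
  by rewrite (disjointFl (disj _ _ ji) bi).
rewrite big1 // => i _; case: (boolP (b \in V i)) => // bi.
by case/bigcupP: bV; exists i.
Qed.

Theorem corollary1 (S B : nat) (H : option nat) (C : config S B)
    (hC : initial_config H C)
    (k : nat) (V : 'I_k -> {set 'I_B})
    (hV : forall i : 'I_k, virtual_layer C (V i))
    (hdisj : forall i j : 'I_k, i != j -> [disjoint V i & V j])
    (hP5 : forall i : 'I_k, P5 C (V i))
    (ms : seq (move S)) (hms : feasible H C ms) :
  k <= num_non_BG_on (\bigcup_(i < k) V i) C ms.
Proof.
apply: leq_trans (sum_num_non_BG_disjoint _ _ hdisj).
rewrite -[X in X <= _]card_ord -sum1_card leq_sum // => i _.
apply: (num_non_BG_layer_gt0 (hP5 i) _ hms).
exact: layer_in_place_init.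
Qed.
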